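(* Consider feature matrices with entries in $\{-1,0,+1\}$. (a) Suppose that for some real constants $c$, $\beta$ and $A>0$ the following holds: for all $m,N\ge1$, every $\mathbf M\in\{-1,0,+1\}^{m\times N}$, every nonzero $\lambda^*\in\mathbb R^N$ and every $\varepsilon>0$, every run of AdaBoost on $\mathbf M$ achieves loss at most $L(\lambda^* )+\varepsilon$ in at most $\lceil A\,\|\lambda^*\|_1^{c}\,\varepsilon^{-\beta}\rceil$ rounds. Then $c\ge1$. (b) There is no polynomial $p$ in three variables such that for all $m,N\ge1$, every $\mathbf M\in\{-1,0,+1\}^{m\times N}$, every $\lambda^*\in\mathbb R^N$ and every $\varepsilon>0$, every run of AdaBoost on $\mathbf M$ achieves loss at most $L(\lambda^* )+\varepsilon$ in at most $p(1/\varepsilon,m,N)$ rounds.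
   Context: For a feature matrix $\mathbf M$ with $m$ rows (examples) and $N$ columns (weak hypotheses), the exponential loss of $\lambda\in\mathbb R^N$ is $L(\lambda)=\frac1m\sum_{i=1}^m e^{-(\mathbf M\lambda)_i}$. AdaBoost: start with $\lambda^0=0$. In round $t=1,2,\dots$, let $D_t(i)=e^{-(\mathbf M\lambda^{t-1})_i}/\sum_{k=1}^m e^{-(\mathbf M\lambda^{t-1})_k}$, choose a column $j_t$ maximizing $\left|\sum_i D_t(i)M_{ij}\right|$ over $j$ (ties broken arbitrarily), put $r_t=\sum_i D_t(i)M_{ij_t}$ and $\alpha_t=\frac12\ln\frac{1+r_t}{1-r_t}$, and set $\lambda^t=\lambda^{t-1}+\alpha_t\mathbf e_{j_t}$, where $\mathbf e_j$ is the $j$-th standard basis vector. If $|r_t|=1$, the step is infinite; the loss after round $t$ is then taken to be its limiting value $0$ and the algorithm stops (all later losses are $0$). ''Achieves loss at most $x$ in at most $n$ rounds'' means $L(\lambda^t)\le x$ for some $t\le n$. *)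

(* Defs.v *)
From HB Require Import structures.
From mathcomp Require Import all_boot all_order all_algebra.
From mathcomp Require Import reals sequences exp.
(* Not imported: the notations of mpoly clash with those of MathComp-Analysis. *)
From mathcomp.multinomials Require mpoly.

Set Implicit Arguments.
Unset Strict Implicit.
Unset Printing Implicit Defensive.

Import Order.TTheory GRing.Theory Num.Theory.
Local Open Scope ring_scope.

Section AdaBoost.
Variables (R : realType) (m N : nat).
Implicit Types (M : 'M[R]_(m, N)) (lam : 'cV[R]_N) (s : nat -> option 'cV[R]_N).

Definition ternary M : Prop := forall i j, M i j \in [:: -1; 0; 1].

Definition l1norm lam : R := \sum_j `|lam j 0|.

Definition exp_loss M lam : R := m%:R^-1 * \sum_i expR (- (M *m lam) i 0).

(* D_{t+1} in terms of lam = lambda^t. *)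
Definition distribution M lam (i : 'I_m) : R :=
  expR (- (M *m lam) i 0) / \sum_k expR (- (M *m lam) k 0).

Definition edge M lam (j : 'I_N) : R :=
  \sum_i distribution M lam i * M i j.

Definition step_size (r : R) : R := 2^-1 * ln ((1 + r) / (1 - r)).

(* The state after a round is [Some lam] while lambda^t = lam is finite, and
   [None] once a round with |r_t| = 1 (an infinite step) has taken place. *)
Definition adaboost_step M (x y : option 'cV[R]_N) : Prop :=
  if x is Some lam then
    exists j : 'I_N,
      (forall k : 'I_N, `|edge M lam k| <= `|edge M lam j|) /\
      y = if `|edge M lam j| == 1 then None
          else Some (lam + step_size (edge M lam j) *: delta_mx j 0)
  else y = None.

(* A relation, not a function: ties in the choice of j_t are broken
   arbitrarily.  A stopped run is continued by [None] forever. *)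
Definition adaboost_run M s : Prop :=
  s 0%N = Some 0 /\ forall t, adaboost_step M (s t) (s t.+1).

Definition state_loss M (x : option 'cV[R]_N) : R :=
  if x is Some lam then exp_loss M lam else 0.

Definition achieves_loss_within M s (x n : R) : Prop :=
  exists t : nat, t%:R <= n /\ state_loss M (s t) <= x.

End AdaBoost.

Definition eval3 (R : realType) (p : mpoly.mpoly 3 R) (x y z : R) : R :=
  mpoly.meval (fun i : 'I_3 => tnth [tuple x; y; z] i) p.

(* Main.v *)
Require Import Defs.
From mathcomp Require Import all_boot all_order all_algebra.
From mathcomp Require Import reals sequences exp.
From mathcomp Require Import ring lra.
From mathcomp.multinomials Require mpoly.

(** For each n >= 2 there is a ternary n x n matrix on which every vector of
    small loss has exponentially large norm, while AdaBoost can only increase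
    its norm slowly; this rules out both kinds of upper bound.

    The matrix is lower triangular, with +1 on the diagonal and -1 below, so
    that the margin of example i is lam_i minus the sum of the earlier
    coordinates.  The prefix sums S_k of lam therefore satisfy
    S_(k+1) = 2 S_k + margin_k [prefix_sumS].  If all margins are at least b,
    then the norm is at least (2^n - 1) b [l1norm_ge_margin], and lam_j = a 2^j
    attains this with all margins equal to a.

    On the other side, a round of step a multiplies the loss by a factor Z with
    Z exp |a| <= 2 [step_factor_le2]: Z is at most
    (1+r)/2 exp (-a) + (1-r)/2 exp a, and exp (2 a) = (1+r)/(1-r).  Hence
    L(lambda^t) exp |lambda^t|_1 <= 2^t along every run [run_loss_norm].  Loss L
    forces every margin to be at least -ln (n L) [margin_ge_loss], so
    L (n L)^-(2^n - 1) <= 2^t, and reaching n L <= 1/(2n) takes at least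
    2^n - 2 rounds [doubling_rounds_ge].

    With a = ln (4 n^2) the comparison vector has loss 1/(4 n^2); the choice
    eps = 1/(4 n^2) asks for loss 1/(2 n^2), which is exactly the threshold
    above, and the norm of the comparison vector is (2^n - 1) ln (4 n^2).  A
    bound of the form (a) with c < 1 would give 2^n = O(2^(n max(c, 0)) n^K),
    and a bound of the form (b) would give 2^n = O(n^K). *)

Import Order.TTheory GRing.Theory Num.Theory.
Local Open Scope ring_scope.

Set Implicit Arguments.
Unset Strict Implicit.
Unset Printing Implicit Defensive.

(** * Growth estimates *)

(** With d = ln q, 1 + x <= exp x gives
    q^n = (exp (n d / (k+1)))^(k+1) >= (n d / (k+1))^(k+1), which is a constant
    times n^(k+1). *)
Lemma exp_dominates_poly (R : realType) (q C : R) (k : nat) : 1 < q ->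
  exists2 n : nat, (1 < n)%N & C * n%:R ^+ k < q ^+ n.
Proof.
move=> q1; have q0 : 0 < q by apply: lt_trans q1.
have d0 : 0 < ln q by rewrite ln_gt0.
pose e := (ln q / k.+1%:R) ^+ k.+1.
have e0 : 0 < e by rewrite exprn_gt0 // divr_gt0.
exists (Num.Def.archi_bound `|C / e|).+2 => //.
set n := _.+2.
have Cn : C < n%:R * e.
  rewrite -ltr_pdivrMr //; apply: le_lt_trans (ler_norm _) _.
  apply: lt_trans (archi_boundP (normr_ge0 _)) _.
  by rewrite ltr_nat /n ltnS leqnSn.
have -> : q ^+ n = expR (n%:R * (ln q / k.+1%:R)) ^+ k.+1.
  rewrite -expRM_natl mulrCA [k.+1%:R * _]mulrC divfK ?pnatr_eq0 //.
  by rewrite expRM_natl lnK.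
have x0 : 0 <= n%:R * (ln q / k.+1%:R).
  by rewrite mulr_ge0 // divr_ge0 // ltW.
apply: (@lt_le_trans _ _ ((n%:R * (ln q / k.+1%:R)) ^+ k.+1)); last first.
  apply: lerXn2r; rewrite ?nnegrE ?expR_ge0 //.
  by apply: le_trans (expR_ge1Dx _); rewrite lerDr.
rewrite exprMn -/e exprS mulrAC ltr_pM2r // exprn_gt0 // ltr0n //.
Qed.

(** The value is at most the sum of the absolute values of the coefficients
    times x to the largest total degree.  Indexing the monomials by their
    position in the support reduces both to sums and maxima over ordinals. *)
Lemma eval3_le (R : realType) (p : mpoly.mpoly 3 R) :
  exists C : R, exists k : nat, forall x y z : R,
    1 <= x -> 0 <= y <= x -> 0 <= z <= x -> eval3 p x y z <= C * x ^+ k.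
Proof.
pose u l := tnth (in_tuple (mpoly.msupp p)) l.
pose d l := (\sum_i mpoly.fun_of_multinom (u l) i)%N.
exists (\sum_l `|mpoly.mcoeff (u l) p|), (\max_l d l)%N.
move=> x y z x1 /andP[y0 yx] /andP[z0 zx].
rewrite /eval3 mpoly.mevalE mulr_suml [leLHS]big_tnth; apply: ler_sum => l _.
apply: le_trans (ler_norm _) _; rewrite normrM ler_wpM2l //.
have x0 : 0 <= x by apply: le_trans x1.
have v i : 0 <= tnth [tuple x; y; z] i <= x.
  have /= : tnth [tuple x; y; z] i \in [:: x; y; z] by apply: mem_tnth.
  by rewrite !inE => /or3P[] /eqP ->; rewrite ?x0 ?lexx ?y0 ?z0.
rewrite ger0_norm; last first.
  by apply: prodr_ge0 => i _; rewrite exprn_ge0 //; case/andP: (v i).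
apply: (@le_trans _ _ (x ^+ d l)); last by rewrite ler_weXn2l // leq_bigmax.
rewrite -prodrXr; apply: ler_prod => i _; case/andP: (v i) => v0 vx.
by rewrite exprn_ge0 //= lerXn2r.
Qed.

(** From exp (-1/2) >= 1/2; used to see that ln (4 n^2) >= 1. *)
Lemma expR1_le4 (R : realType) : expR 1 <= 4 :> R.
Proof.
have e : expR 1 = (expR (- 2^-1)) ^- 2 :> R.
  by rewrite -expRM_natl -expRN; congr expR; field.
have h : 2^-1 <= expR (- 2^-1) :> R.
  by apply: le_trans (expR_ge1Dx _); lra.
rewrite e -[4]invrK lef_pV2 ?posrE ?exprn_gt0 ?expR_gt0 ?invr_gt0 //.
have -> : (4^-1 : R) = 2^-1 ^+ 2 by field.
by rewrite lerXn2r // nnegrE // ltW ?expR_gt0 // invr_gt0.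
Qed.

(** Replaces an arbitrary real exponent, possibly negative, by a natural one. *)
Lemma powR_le_natural_exponent (R : realType) (x b : R) : 1 <= x ->
  x `^ b <= x ^+ (Num.Def.archi_bound `|b|).
Proof.
move=> x1; rewrite -powR_mulrn ?(le_trans ler01) //; apply: ler_powR => //.
by apply: le_trans (ler_norm _) _; apply/ltW/archi_boundP.
Qed.

(** * Loss and norm along a run *)

Lemma sum_expR_gt0 (R : realType) (m N : nat) (M : 'M[R]_(m, N))
    (lam : 'cV[R]_N) :
  (0 < m)%N -> 0 < \sum_i expR (- (M *m lam) i 0).
Proof.
case: m M => // m M _.
rewrite big_ord_recl ltr_wpDr ?expR_gt0 // sumr_ge0 // => i _; exact: expR_ge0.
Qed.

Lemma exp_loss_gt0 (R : realType) (m N : nat) (M : 'M[R]_(m, N))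
    (lam : 'cV[R]_N) :
  (0 < m)%N -> 0 < exp_loss M lam.
Proof. by move=> m0; rewrite mulr_gt0 ?invr_gt0 ?ltr0n ?sum_expR_gt0. Qed.

Lemma distribution_gt0 (R : realType) (m N : nat) (M : 'M[R]_(m, N))
    (lam : 'cV[R]_N) (i : 'I_m) :
  0 < distribution M lam i.
Proof. by rewrite divr_gt0 ?expR_gt0 // sum_expR_gt0 ?(leq_ltn_trans _ (ltn_ord i)). Qed.

Lemma sum_distribution (R : realType) (m N : nat) (M : 'M[R]_(m, N))
    (lam : 'cV[R]_N) :
  (0 < m)%N -> \sum_i distribution M lam i = 1.
Proof. by move=> m0; rewrite -mulr_suml divff // gt_eqF ?sum_expR_gt0. Qed.

Lemma exp_loss_step (R : realType) (m N : nat) (M : 'M[R]_(m, N))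
    (lam : 'cV[R]_N) (j : 'I_N) (a : R) :
  (0 < m)%N ->
  exp_loss M (lam + a *: delta_mx j 0) =
  exp_loss M lam * \sum_i distribution M lam i * expR (- (a * M i j)).
Proof.
move=> m0; rewrite /exp_loss -mulrA; congr (_ * _).
rewrite mulr_sumr; apply: eq_bigr => i _.
rewrite mulrA [_ * distribution _ _ _]mulrC divfK ?gt_eqF ?sum_expR_gt0 //.
rewrite -expRD; congr expR.
rewrite mulmxDr -scalemxAr -colE !mxE; ring.
Qed.

Lemma edge_lt1 (R : realType) (m N : nat) (M : 'M[R]_(m, N))
    (lam : 'cV[R]_N) (j : 'I_N) (i : 'I_m) :
  ternary M -> M i j < 1 -> edge M lam j < 1.
Proof.
move=> ternM Mij.
have m0 : (0 < m)%N by apply: leq_ltn_trans (ltn_ord i).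
rewrite -(@sum_distribution _ _ _ M lam m0) /edge.
rewrite (bigD1 i) //= [ltRHS](bigD1 i) //= ltr_leD //.
  by rewrite gtr_pMr ?distribution_gt0.
apply: ler_sum => k _; rewrite ler_piMr ?(ltW (distribution_gt0 _ _ _)) //.
by have := ternM k j; rewrite !inE => /or3P[] /eqP ->; lra.
Qed.

Lemma ternaryN (R : realType) (m N : nat) (M : 'M[R]_(m, N)) :
  ternary M -> ternary (- M).
Proof.
move=> ternM i j; have := ternM i j; rewrite !inE mxE => /or3P[] /eqP ->.
- by rewrite opprK eqxx !orbT.
- by rewrite oppr0 eqxx !orbT.
- by rewrite eqxx.
Qed.

Lemma edge_gtN1 (R : realType) (m N : nat) (M : 'M[R]_(m, N))
    (lam : 'cV[R]_N) (j : 'I_N) (i : 'I_m) :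
  ternary M -> -1 < M i j -> -1 < edge M lam j.
Proof.
move=> ternM Mij.
have -> : edge M lam j = - edge (- M) (- lam) j.
  rewrite /edge -sumrN; apply: eq_bigr => k _.
  by rewrite /distribution mulNmx mulmxN opprK [(- M) k j]mxE mulrN opprK.
rewrite ltrN2; apply: (@edge_lt1 _ _ _ _ _ _ i); first exact: ternaryN.
by rewrite mxE ltrNl.
Qed.

(** Convexity of exp, specialised to the three admissible values of x. *)
Lemma expR_ternary_chord (R : realType) (a x : R) : x \in [:: -1; 0; 1] ->
  expR (- (a * x)) <= (1 + x) / 2 * expR (- a) + (1 - x) / 2 * expR a.
Proof.
rewrite !inE => /or3P[] /eqP ->.
- by rewrite mulrN1 opprK; lra.
- rewrite mulr0 oppr0 addr0 expR0 !expRN.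
  have E0 := expR_gt0 a; set E := expR a in E0 *.
  rewrite -subr_ge0.
  suff -> : 1 / 2 * E^-1 + 1 / 2 * E - 1 = (E - 1) ^+ 2 / (2 * E).
    by rewrite divr_ge0 ?sqr_ge0 // mulr_ge0 // ltW.
  by field; rewrite gt_eqF.
- by rewrite mulr1; lra.
Qed.

(** Let E = exp a, so that E^2 = (1+r)/(1-r).  Multiplying the chord bound
    (1+r)/2 E^-1 + (1-r)/2 E by E gives 1 + r, and multiplying it by E^-1 gives
    1 - r; one of these is the case exp |a| = E or E^-1. *)
Lemma step_factor_le2 (R : realType) (m N : nat) (M : 'M[R]_(m, N))
    (lam : 'cV[R]_N) (j : 'I_N)
    (a := step_size (edge M lam j)) :
  (0 < m)%N -> ternary M -> `|edge M lam j| < 1 ->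
  (\sum_i distribution M lam i * expR (- (a * M i j))) * expR `|a| <= 2.
Proof.
move=> m0 ternM; rewrite ltr_norml; set r := edge M lam j => /andP[rN1 r1].
have Z_le : \sum_i distribution M lam i * expR (- (a * M i j)) <=
    (1 + r) / 2 * expR (- a) + (1 - r) / 2 * expR a.
  apply: (@le_trans _ _ (\sum_i distribution M lam i *
      ((1 + M i j) / 2 * expR (- a) + (1 - M i j) / 2 * expR a))).
    apply: ler_sum => i _; rewrite ler_wpM2l ?expR_ternary_chord //.
    exact: ltW (distribution_gt0 _ _ _).
  rewrite le_eqVlt; apply/orP; left; apply/eqP.
  rewrite (eq_bigr (fun i => (expR (- a) + expR a) / 2 * distribution M lam i
     + (expR (- a) - expR a) / 2 * (distribution M lam i * M i j))).
    rewrite big_split /= -!mulr_sumr sum_distribution // -/(edge M lam j) -/r.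
    by field.
  by move=> i _; field.
have E2 : expR a ^+ 2 = (1 + r) / (1 - r).
  rewrite -expRM_natl /a /step_size mulVKf ?pnatr_eq0 // lnK //.
  by rewrite posrE divr_gt0 -/r //; lra.
have E0 := expR_gt0 a.
apply: le_trans (ler_wpM2r (expR_ge0 _) Z_le) _.
have [a0|a0] := leP 0 a.
- rewrite ger0_norm // mulrDl -!mulrA -!expRD addNr expR0 expRD -expr2 E2.
  suff -> : (1 + r) * (2^-1 * 1) + (1 - r) * (2^-1 * ((1 + r) / (1 - r))) = 1 + r.
    by lra.
  by field; rewrite subr_eq0 gt_eqF.
- rewrite ltr0_norm // mulrDl -!mulrA -!expRD addrN expR0 expRD -expr2 expRN exprVn E2.
  suff -> : (1 + r) * (2^-1 * ((1 + r) / (1 - r))^-1) + (1 - r) * (2^-1 * 1) = 1 - r.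
    by lra.
  by field; rewrite subr_eq0 gt_eqF //= addrC -[1]opprK subr_eq0 gt_eqF.
Qed.

Lemma l1norm_step (R : realType) (N : nat) (lam : 'cV[R]_N) (j : 'I_N) (a : R) :
  l1norm (lam + a *: delta_mx j 0) <= l1norm lam + `|a|.
Proof.
have -> : `|a| = \sum_k `|(a *: (delta_mx j 0 : 'cV[R]_N)) k 0|.
  rewrite (bigD1 j) //= big1 => [|k kj]; rewrite !mxE.
    by rewrite !eqxx mulr1 addr0.
  by rewrite (negPf kj) mulr0 normr0.
rewrite /l1norm -big_split; apply: ler_sum => k _.
by rewrite [X in `|X|]mxE ler_normD.
Qed.

(** A step of size a divides the loss by at least exp |a| / 2 and adds at most
    |a| to the norm, so the product on the left at most doubles in each round. *)
Lemma run_loss_norm (R : realType) (m N : nat) (M : 'M[R]_(m, N))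
    (s : nat -> option 'cV[R]_N) (t : nat) (lam : 'cV[R]_N) :
  (0 < m)%N -> ternary M -> adaboost_run M s -> s t = Some lam ->
  exp_loss M lam * expR (l1norm lam) <= 2 ^+ t.
Proof.
move=> m0 ternM [s0 sS]; elim: t lam => [|t IHt] lam.
  rewrite s0 => -[<-]; rewrite /exp_loss /l1norm.
  rewrite [X in expR X]big1 ?expR0 ?mulr1 => [|j _]; last by rewrite mxE normr0.
  rewrite (eq_bigr (fun=> 1)) => [|i _]; last by rewrite mulmx0 mxE oppr0 expR0.
  by rewrite sumr_const card_ord mulVf // pnatr_eq0 -lt0n.
have := sS t; case: (s t) IHt => [lam0|] IHt; last by move=> /= -> .
case=> j [_ ->]; case: eqP => // /eqP r1 [<-].
have r_lt1 : `|edge M lam0 j| < 1.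
  rewrite lt_neqAle r1 /=.
  rewrite -(@sum_distribution _ _ _ M lam0 m0) (le_trans (ler_norm_sum _ _ _)) //.
  apply: ler_sum => i _; rewrite normrM gtr0_norm ?distribution_gt0 //.
  rewrite ler_piMr ?(ltW (distribution_gt0 _ _ _)) //.
  by have := ternM i j; rewrite !inE => /or3P[] /eqP ->;
    rewrite ?normrN1 ?normr0 ?normr1.
rewrite exp_loss_step // exprS.
have := step_factor_le2 m0 ternM r_lt1.
set a := step_size _; set Z := \sum_i _ => ZE.
have Z0 : 0 <= Z.
  apply: sumr_ge0 => i _.
  by rewrite mulr_ge0 ?expR_ge0 ?(ltW (distribution_gt0 _ _ _)).
have L0 := ltW (exp_loss_gt0 M lam0 m0).
apply: (@le_trans _ _ ((Z * expR `|a|) * (exp_loss M lam0 * expR (l1norm lam0)))).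
  rewrite [leRHS](_ : _ = exp_loss M lam0 * Z * expR (l1norm lam0 + `|a|)).
    apply: ler_wpM2l; first exact: mulr_ge0.
    by rewrite ler_expR l1norm_step.
  by rewrite expRD; ring.
apply: ler_pM; [| | exact: ZE | exact: IHt].
- by rewrite mulr_ge0 ?expR_ge0.
- by rewrite mulr_ge0 ?expR_ge0.
Qed.

(** The upper bounds to be refuted speak of every run, so a contradiction needs
    at least one. *)
Lemma adaboost_run_exists (R : realType) (m N : nat) (M : 'M[R]_(m, N)) :
  (0 < N)%N -> exists s, adaboost_run M s.
Proof.
move=> N0; pose j0 := Ordinal N0.
pose best lam := [arg max_(j > j0) `|edge M lam j|]%O.
pose next (x : option 'cV[R]_N) := if x is Some lam then
    if `|edge M lam (best lam)| == 1 then None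
    else Some (lam + step_size (edge M lam (best lam)) *: delta_mx (best lam) 0)
  else None.
exists (fun t => iter t next (Some 0)); split=> // t.
rewrite iterS; case: (iter t _ _) => [lam|] //=.
exists (best lam); split=> // k; rewrite /best.
by case: arg_maxP => // j _; apply.
Qed.

(** * A matrix that forces the norm to double *)

(** Nonnegative margins force each coordinate to be at least the sum of all
    earlier ones, which makes the coordinates grow like powers of 2. *)
Definition doubling_mx (R : realType) (n : nat) : 'M[R]_n :=
  \matrix_(i, j) ((i == j)%:R - (j < i)%N%:R).

Lemma ternary_doubling_mx (R : realType) (n : nat) :
  ternary (doubling_mx R n).
Proof.
move=> i j; rewrite mxE !inE; case: (eqVneq i j) => [->|_].
  by rewrite ltnn subr0 eqxx !orbT.
by case: (j < i)%N; rewrite /= sub0r ?oppr0 eqxx ?orbT.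
Qed.

Lemma doubling_margin (R : realType) (n : nat) (lam : 'cV[R]_n) (i : 'I_n) :
  (doubling_mx R n *m lam) i 0 = lam i 0 - \sum_(j < n | (j < i)%N) lam j 0.
Proof.
rewrite mxE (bigD1 i) //= [in RHS]big_mkcond [in RHS](bigD1 i) //=.
rewrite mxE eqxx ltnn /= subr0 mul1r add0r; congr (_ + _).
rewrite -sumrN; apply: eq_bigr => j ji.
rewrite mxE eq_sym (negPf ji) sub0r; case: (j < i)%N; first by rewrite mulN1r.
by rewrite !oppr0 mul0r.
Qed.

(** Each coordinate is its margin plus the preceding prefix sum. *)
Lemma prefix_sumS (R : realType) (n : nat) (lam : 'cV[R]_n) (i : 'I_n) :
  \sum_(j < n | (j < i.+1)%N) lam j 0 =
  (\sum_(j < n | (j < i)%N) lam j 0) *+ 2 + (doubling_mx R n *m lam) i 0.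
Proof.
rewrite doubling_margin mulr2n -addrA [X in _ + X]addrCA addrN addr0.
rewrite (bigD1 i) //= addrC; congr (_ + _); apply: eq_bigl => j.
by rewrite ltnS -val_eqE /= andbC -ltn_neqAle.
Qed.

Lemma l1norm_ge_margin (R : realType) (n : nat) (lam : 'cV[R]_n) (b : R) :
  (forall i, b <= (doubling_mx R n *m lam) i 0) ->
  (2 ^+ n - 1) * b <= l1norm lam.
Proof.
move=> lam_b.
have prefix_ge k : (k <= n)%N ->
    (2 ^+ k - 1) * b <= \sum_(j < n | (j < k)%N) lam j 0.
  elim: k => [_|k IHk kn].
    by rewrite subrr mul0r big1.
  have := prefix_sumS lam (Ordinal kn); rewrite /= => ->.
  have := IHk (ltnW kn); have := lam_b (Ordinal kn); rewrite exprS.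
  set P := 2 ^+ k; set S := \sum_(j < n | _) _; lra.
apply: le_trans (prefix_ge n (leqnn n)) _.
rewrite (eq_bigl predT) => [|j]; last by rewrite ltn_ord.
by apply: ler_sum => j _; apply: ler_norm.
Qed.

(** The vector with all margins equal to a. *)
Definition doubling_vec (R : realType) (n : nat) (a : R) : 'cV[R]_n :=
  \col_j (a * 2 ^+ j).

Lemma doubling_vec_sum (R : realType) (n : nat) (a : R) (k : nat) :
  (k <= n)%N ->
  \sum_(j < n | (j < k)%N) doubling_vec n a j 0 = a * (2 ^+ k - 1).
Proof.
move=> kn; rewrite (eq_bigr (fun j : 'I_n => a * 2 ^+ j)); last first.
  by move=> j _; rewrite mxE.
rewrite -(big_ord_widen n (fun j => a * 2 ^+ j) kn) -mulr_sumr; congr (a * _).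
by rewrite subrX1 (_ : 2 - 1 = 1 :> R) ?mul1r //; ring.
Qed.

Lemma doubling_vec_margin (R : realType) (n : nat) (a : R) (i : 'I_n) :
  (doubling_mx R n *m doubling_vec n a) i 0 = a.
Proof.
rewrite doubling_margin doubling_vec_sum ?(ltnW (ltn_ord i)) // mxE; ring.
Qed.

Lemma doubling_vec_norm (R : realType) (n : nat) (a : R) :
  0 <= a -> l1norm (doubling_vec n a) = (2 ^+ n - 1) * a.
Proof.
move=> a0; rewrite mulrC -(doubling_vec_sum a (leqnn n)) /l1norm.
rewrite [RHS](eq_bigl predT) => [|j]; last by rewrite ltn_ord.
by apply: eq_bigr => j _; rewrite ger0_norm // mxE mulr_ge0 // exprn_ge0.
Qed.

Lemma doubling_vec_loss (R : realType) (n : nat) (a : R) :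
  (0 < n)%N -> exp_loss (doubling_mx R n) (doubling_vec n a) = expR (- a).
Proof.
move=> n0; rewrite /exp_loss.
rewrite (eq_bigr (fun=> expR (- a))) => [|i _]; last by rewrite doubling_vec_margin.
by rewrite sumr_const card_ord -[expR _ *+ n]mulr_natl mulKf // pnatr_eq0 -lt0n.
Qed.

(** No column is constantly +1 or constantly -1: row j has +1 in column j, row 1
    has -1 in column 0, and row 0 has 0 in every other column. *)
Lemma doubling_edge_lt1 (R : realType) (n : nat) (lam : 'cV[R]_n) (j : 'I_n) :
  (1 < n)%N -> `|edge (doubling_mx R n) lam j| < 1.
Proof.
move=> n1; have tern := @ternary_doubling_mx R n.
rewrite ltr_norml (@edge_gtN1 _ _ _ _ lam j j) //; last first.
  by rewrite mxE eqxx ltnn /=; lra.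
have [j0|j_gt0] := posnP j.
  apply: (@edge_lt1 _ _ _ _ lam j (Ordinal n1)) => //.
  by rewrite mxE -val_eqE /= j0 /=; lra.
apply: (@edge_lt1 _ _ _ _ lam j (Ordinal (ltnW n1))) => //.
by rewrite mxE -val_eqE /= ltn_eqF //=; lra.
Qed.

Lemma doubling_run_finite (R : realType) (n : nat)
    (s : nat -> option 'cV[R]_n) (t : nat) :
  (1 < n)%N -> adaboost_run (doubling_mx R n) s -> exists lam, s t = Some lam.
Proof.
move=> n1 [s0 sS]; elim: t => [|t [lam st]]; first by exists 0.
have := sS t; rewrite st /= => -[j [_ ->]].
by rewrite lt_eqF ?doubling_edge_lt1 //; eexists.
Qed.

(** A single summand of m times the loss is at most the whole sum. *)
Lemma margin_ge_loss (R : realType) (m N : nat) (M : 'M[R]_(m, N))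
    (lam : 'cV[R]_N) (i : 'I_m) :
  - ln (m%:R * exp_loss M lam) <= (M *m lam) i 0.
Proof.
have m0 : (0 < m)%N by apply: leq_ltn_trans (ltn_ord i).
rewrite /exp_loss mulVKf ?pnatr_eq0 -?lt0n // lerNl -ler_expR lnK.
  rewrite (bigD1 i) //= lerDl sumr_ge0 // => k _; exact: expR_ge0.
by rewrite posrE sum_expR_gt0.
Qed.

(** Let y = (n L)^-1.  The margins are at least ln y, so
    exp |lambda^t|_1 >= y^(2^n - 1) and 2^t >= L y^(2^n - 1) = y^(2^n - 2) / n.
    As y >= 2n and 2^n - 2 >= 1, one factor n of y^(2^n - 2) absorbs the
    division. *)
Lemma doubling_rounds_ge (R : realType) (n : nat)
    (s : nat -> option 'cV[R]_n) (t : nat) :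
  (1 < n)%N -> adaboost_run (doubling_mx R n) s ->
  n%:R * state_loss (doubling_mx R n) (s t) <= (n.*2)%:R^-1 ->
  (2 ^ n - 2 <= t)%N.
Proof.
move=> n1 run; have [lam st] := doubling_run_finite t n1 run.
have n0 := ltnW n1.
have := run_loss_norm n0 (@ternary_doubling_mx R n) run st.
rewrite st /=; set L := exp_loss _ _ => Lt nL.
have L0 : 0 < L by apply: exp_loss_gt0.
have nR0 : 0 < n%:R :> R by rewrite ltr0n.
have nL0 : 0 < n%:R * L by apply: mulr_gt0.
pose y := (n%:R * L)^-1.
have y_ge : n.*2%:R <= y.
  by rewrite /y -[leLHS]invrK lef_pV2 // posrE invr_gt0 ltr0n double_gt0.
(* The three exponents 2^n, 2^n - 1 and 2^n - 2 become k.+3, k.+2 and k.+1. *)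
have [k kE] : exists k, (2 ^ n = k.+3)%N.
  have : (2 ^ 2 <= 2 ^ n)%N by rewrite leq_exp2l.
  by case: (2 ^ n)%N => [|[|[|k]]] // _; exists k.
have y0 : 0 < y by rewrite invr_gt0.
have norm_ge : y ^+ k.+2 <= expR (l1norm lam).
  have -> : y ^+ k.+2 = expR ((2 ^+ n - 1) * - ln (n%:R * L)).
    rewrite -lnV ?posrE // -/y -natrX kE -[k.+3]addn1 natrD addrK.
    by rewrite expRM_natl lnK // posrE.
  by rewrite ler_expR; apply: l1norm_ge_margin; apply: margin_ge_loss.
have : (2 : R) ^+ k.+1 <= 2 ^+ t.
  apply: le_trans Lt; apply: (@le_trans _ _ (L * y ^+ k.+2)); last first.
    by rewrite ler_wpM2l // ltW.
  have -> : L * y ^+ k.+2 = y ^+ k.+1 / n%:R.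
    by rewrite exprS /y; field; rewrite !gt_eqF.
  rewrite ler_pdivlMr //.
  apply: (@le_trans _ _ (n.*2%:R ^+ k.+1)); last first.
    by rewrite lerXn2r ?nnegrE ?ler0n ?(ltW y0).
  rewrite -mul2n natrM exprMn ler_wpM2l ?exprn_ge0 // exprS.
  by rewrite ler_peMr ?exprn_ege1 ?ler1n // ltW.
by rewrite ler_eXn2l ?ltr1n // kE.
Qed.

(** * The lower bound and its consequences *)

Lemma exponential_rounds (R : realType) (n : nat) : (1 < n)%N ->
  exists (M : 'M[R]_n) (lam : 'cV[R]_n) (s : nat -> option 'cV[R]_n),
  [/\ ternary M, adaboost_run M s,
      l1norm lam = (2 ^+ n - 1) * ln (4 * n%:R ^+ 2) &
      forall x, achieves_loss_within M s
        (exp_loss M lam + (4 * n%:R ^+ 2)^-1) x -> 2 ^+ n - 2 <= x].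
Proof.
move=> n1; have n0 := ltnW n1.
have nR1 : 1 <= n%:R :> R by rewrite ler1n.
have nR0 : 0 < n%:R :> R by rewrite ltr0n.
set a := ln _; have a0 : 0 <= a.
  by rewrite ln_ge0 // expr2; nra.
have [s run] := adaboost_run_exists (doubling_mx R n) n0.
exists (doubling_mx R n), (doubling_vec n a), s; split=> //.
- exact: ternary_doubling_mx.
- exact: doubling_vec_norm.
move=> x [t [tx]]; rewrite doubling_vec_loss // expRN lnK; last first.
  by rewrite posrE mulr_gt0 // exprn_gt0.
move=> Lt; apply: le_trans tx.
rewrite -natrX lerBlDr -natrD ler_nat addnC -leq_subLR.
apply: (doubling_rounds_ge n1 run).
apply: le_trans (ler_wpM2l (ltW nR0) Lt) _.
rewrite -mul2n natrM le_eqVlt; apply/orP; left; apply/eqP.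
by field; rewrite gt_eqF.
Qed.

Theorem corollary11 (R : realType) :
  (forall c beta A : R, 0 < A ->
     (forall (m N : nat) (M : 'M[R]_(m, N)) (lam : 'cV[R]_N) (eps : R)
             (s : nat -> option 'cV[R]_N),
        (1 <= m)%N -> (1 <= N)%N -> ternary M -> lam != 0 -> 0 < eps ->
        adaboost_run M s ->
        achieves_loss_within M s (exp_loss M lam + eps)
          (Num.ceil (A * l1norm lam `^ c * eps `^ (- beta)))%:~R) ->
     1 <= c)
  /\
  ~ (exists p : mpoly.mpoly 3 R,
       forall (m N : nat) (M : 'M[R]_(m, N)) (lam : 'cV[R]_N) (eps : R)
              (s : nat -> option 'cV[R]_N),
         (1 <= m)%N -> (1 <= N)%N -> ternary M -> 0 < eps ->
         adaboost_run M s ->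
         achieves_loss_within M s (exp_loss M lam + eps)
           (eval3 p (1 / eps) m%:R N%:R)).
Proof.
split=> [c beta A A0 bound|[p bound]]; last first.
  have [C [k p_le]] := eval3_le p.
  have [n n1 n_big] : exists2 n : nat, (1 < n)%N &
      ((`|C| * 4 ^+ k + 2) * n%:R ^+ (2 * k) < 2 ^+ n :> R).
    by apply: exp_dominates_poly; rewrite ltr1n.
  have n0 := ltnW n1.
  have nR1 : 1 <= n%:R :> R by rewrite ler1n.
  have nR0 : 0 < n%:R :> R by rewrite ltr0n.
  have [M [lam [s [ternM run _ rounds]]]] := exponential_rounds R n1.
  have y0 : 0 < 4 * n%:R ^+ 2 :> R by rewrite mulr_gt0 // exprn_gt0.
  have := bound n n M lam (4 * n%:R ^+ 2)^-1 s n0 n0 ternM.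
  rewrite invr_gt0 => /(_ y0 run)/rounds.
  rewrite div1r invrK; apply/negP; rewrite -ltNge.
  have n_le : 0 <= (n%:R : R) <= 4 * n%:R ^+ 2.
    by rewrite ler0n expr2; nra.
  have y1 : 1 <= 4 * n%:R ^+ 2 :> R by rewrite expr2; nra.
  apply: le_lt_trans (p_le _ _ _ y1 n_le n_le) _.
  rewrite exprMn -exprM ltrBrDr.
  apply: le_lt_trans n_big; rewrite mulrDl mulrA; apply: lerD.
    by rewrite ler_wpM2r ?exprn_ge0 // ler_wpM2r ?exprn_ge0 // ler_norm.
  by rewrite ler_peMr // exprn_ege1.
rewrite leNgt; apply/negP => c1.
(* The norms concerned are at least 1, so a bound with negative c implies the
   one with exponent 0. *)
pose d := Num.max c 0.
have d0 : 0 <= d by rewrite le_max lexx orbT.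
have d1 : d < 1 by rewrite gt_max c1 ltr01.
(* The extra factor y accounts for (ln y)^d <= y. *)
pose k := (Num.Def.archi_bound `|beta|).+1.
have [n n1 n_big] : exists2 n : nat, (1 < n)%N &
    ((A + 3) * 4 ^+ k * n%:R ^+ (2 * k) < (2 `^ (1 - d)) ^+ n :> R).
  apply: exp_dominates_poly; have : (1 : R) `^ (1 - d) < 2 `^ (1 - d).
    by apply: gt0_ltr_powR; rewrite ?subr_gt0 ?nnegrE ?ltr1n.
  by rewrite powR1.
have n0 := ltnW n1.
have nR2 : 2 <= n%:R :> R by rewrite ler_nat.
have nR0 : 0 < n%:R :> R by rewrite ltr0n.
have [M [lam [s [ternM run normE rounds]]]] := exponential_rounds R n1.
set y := 4 * n%:R ^+ 2 in normE rounds.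
have y4 : 4 <= y by rewrite /y expr2; nra.
have y0 : 0 < y by lra.
have P4 : 4 <= 2 ^+ n :> R.
  by rewrite -natrX ler_nat (@leq_exp2l 2 2 n).
have ln_ge1 : 1 <= ln y.
  by rewrite -ler_expR lnK ?posrE // (le_trans (expR1_le4 R)).
have norm1 : 1 <= l1norm lam by rewrite normE; nra.
have lam0 : lam != 0.
  apply/eqP => lam0; move: norm1; rewrite lam0 /l1norm big1 ?ler10 // => j _.
  by rewrite mxE normr0.
have := bound n n M lam y^-1 s n0 n0 ternM lam0.
rewrite invr_gt0 => /(_ y0 run)/rounds.
set X := A * _ * _ => ceil_ge.
(* 2 from the round count and 1 from the ceiling. *)
have X_ge : 2 ^+ n <= X + 3.
  have := ceilB1_lt X; rewrite intrD; lra.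
have : X <= A * (2 ^+ n) `^ d * y ^+ k.
  rewrite /X -mulrA -[leRHS]mulrA ler_pM2l // exprS mulrA.
  apply: ler_pM; rewrite ?powR_ge0 //; last first.
    have -> : y^-1 `^ (- beta) = y `^ beta.
      by rewrite -powR_inv1 ?ltW // -powRrM mulN1r opprK.
    by apply: powR_le_natural_exponent; lra.
  apply: (@le_trans _ _ (l1norm lam `^ d)).
    by apply: ler_powR => //; rewrite le_max lexx.
  apply: (@le_trans _ _ ((2 ^+ n * y) `^ d)).
    have ln_lt := ln_sublinear y0.
    by apply: ge0_ler_powR; rewrite ?nnegrE //; rewrite ?normE; nra.
  rewrite powRM ?exprn_ge0 ?(ltW y0) // ler_wpM2l ?powR_ge0 //.
  rewrite -[leRHS]powRr1 ?(ltW y0) //; apply: ler_powR; lra.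
apply/negP; rewrite -ltNge.
pose Q := ((2 : R) ^+ n) `^ d.
have Q1 : 1 <= Q.
  have : (1 : R) `^ d <= Q by apply: ge0_ler_powR; rewrite ?nnegrE; lra.
  by rewrite powR1.
have yk1 : 1 <= y ^+ k by rewrite exprn_ege1 //; lra.
have : (A + 3) * y ^+ k * Q < 2 ^+ n.
  have -> : (2 : R) ^+ n = (2 `^ (1 - d)) ^+ n * Q.
    rewrite /Q -!powR_mulrn ?powR_ge0 // -!powRrM [n%:R * d]mulrC -powRD.
      by rewrite -mulrDl subrK mul1r.
    by rewrite pnatr_eq0 implybT.
  rewrite ltr_pM2r; last by lra.
  by rewrite /y exprMn -exprM mulrA.
have : 1 <= y ^+ k * Q by rewrite mulr_ege1.
rewrite -/Q; lra.
Qed.
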